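(* Let $P$ be a finite nonempty poset. Then the Hibi ideal $H_P$ is Freiman if and only if there exists $p\in P$ such that the subposet $P\setminus\{p\}$ of $P$ is a chain.
   Context: A chain is a totally ordered poset (any two elements are comparable; the empty poset counts as a chain). Fix a field $K$. A subset $I\subset P$ is a poset ideal of $P$ if for all $p,q\in P$ with $p\in I$ and $q\le p$ one has $q\in I$ (the empty set and $P$ are poset ideals); $\mathcal I(P)$ denotes the set of poset ideals of $P$. The Hibi ideal of $P$ is the squarefree monomial ideal $H_P=(\{u_I\}_{I\in\mathcal I(P)})$ in the polynomial ring $S=K[\{x_p,y_p\}_{p\in P}]$, where $u_I=\big(\prod_{p\in I}x_p\big)\big(\prod_{p\in P\setminus I}y_p\big)$. For a graded ideal $L\subset S$, $\mu(L)$ denotes the minimal number of generators of $L$; the fiber cone is $F(L)=\bigoplus_{k\ge 0} L^k/\mathfrak m L^k$ with $\mathfrak m$ the ideal generated by all the variables, and the analytic spread $\ell(L)$ is the Krull dimension of $F(L)$. A monomial ideal $L$ that is equigenerated (minimally generated by monomials of one degree) is called Freiman if $\mu(L^2)=\ell(L)\mu(L)-\binom{\ell(L)}{2}$. *)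

(* Defs.v *)
(* Ideals are Prop-valued predicates; boolp reflects them into bool where the
   subring and quotient constructions require boolean predicates. *)
From HB Require Import structures.
From mathcomp Require Import all_boot all_order all_algebra.
From mathcomp Require Import boolp mpoly.

Set Implicit Arguments.
Unset Strict Implicit.
Unset Printing Implicit Defensive.

Import Order.TTheory GRing.Theory Num.Theory.
Local Open Scope ring_scope.

Section Ideals.
Variable R : comNzRingType.
Implicit Types A I J L : R -> Prop.

Definition ideal_gen A : R -> Prop := fun x =>
  exists2 s : seq (R * R),
    (forall c, c \in s -> A c.2) & x = \sum_(c <- s) c.1 * c.2.

Definition generates (s : seq R) L :=
  forall x, L x <-> ideal_gen (fun y => y \in s) x.

Definition ideal_mul I J : R -> Prop :=
  ideal_gen (fun x => exists a b, [/\ I a, J b & x = a * b]).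

Fixpoint ideal_pow L k : R -> Prop :=
  if k is k'.+1 then ideal_mul L (ideal_pow L k') else fun _ => True.

(* Relational form of [mu L = m]; no value exists if [L] is not a finitely
   generated ideal. *)
Definition min_num_gens L (m : nat) :=
  (exists2 s : seq R, size s = m & generates s L) /\
  (forall s : seq R, generates s L -> (m <= size s)%N).

Definition prime_ideal (p : {pred R}) := idealr_closed p /\ prime_idealr_closed p.

Definition prime_chain (l : nat) :=
  exists p : nat -> {pred R},
    (forall i, (i <= l)%N -> prime_ideal (p i)) /\
    (forall i, (i < l)%N ->
       {subset p i <= p i.+1} /\ ~ {subset p i.+1 <= p i}).

(* Relational form of [dim R = l]; no value exists if the lengths of the
   chains of primes are unbounded. *)
Definition krull_dim (l : nat) :=
  prime_chain l /\ (forall l', prime_chain l' -> (l' <= l)%N).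

Lemma ideal_gen0 A : ideal_gen A 0.
Proof. by exists [::]; rewrite ?big_nil. Qed.

Lemma ideal_genD A x y : ideal_gen A x -> ideal_gen A y -> ideal_gen A (x + y).
Proof.
case=> s sA -> [t tA ->]; exists (s ++ t); last by rewrite big_cat.
by move=> c; rewrite mem_cat => /orP[/sA|/tA].
Qed.

Lemma ideal_genM A a x : ideal_gen A x -> ideal_gen A (a * x).
Proof.
case=> s sA ->; exists [seq (a * c.1, c.2) | c <- s].
  by move=> c /mapP[c' /sA ? ->].
by rewrite big_map big_distrr; apply: eq_bigr => c _; rewrite /= mulrA.
Qed.

Lemma ideal_gen_sum A (T : Type) (r : seq T) (P : pred T) (F : T -> R) :
  (forall i, P i -> ideal_gen A (F i)) -> ideal_gen A (\sum_(i <- r | P i) F i).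
Proof.
move=> AF; elim/big_rec: _ => [|i x Pi Ax]; first exact: ideal_gen0.
by apply: ideal_genD => //; apply: AF.
Qed.

Lemma ideal_gen_mem A x : A x -> ideal_gen A x.
Proof.
move=> Ax; exists [:: (1, x)]; last by rewrite big_seq1 mul1r.
by move=> c; rewrite inE => /eqP ->.
Qed.

Lemma ideal_gen_min A I :
  I 0 -> (forall x y, I x -> I y -> I (x + y)) ->
  (forall a x, I x -> I (a * x)) -> (forall x, A x -> I x) ->
  forall x, ideal_gen A x -> I x.
Proof.
move=> I0 ID IM AI x [s sA ->]; rewrite big_seq.
elim/big_rec: _ => [//|c y cs Iy].
by apply: ID => //; apply: IM; apply/AI/sA.
Qed.

Lemma ideal_pow0 L k : ideal_pow L k 0.
Proof. by case: k => // k; apply: ideal_gen0. Qed.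

Lemma ideal_powD L k x y :
  ideal_pow L k x -> ideal_pow L k y -> ideal_pow L k (x + y).
Proof. by case: k => // k; apply: ideal_genD. Qed.

Lemma ideal_powM L k a x : ideal_pow L k x -> ideal_pow L k (a * x).
Proof. by case: k => // k; apply: ideal_genM. Qed.

Lemma ideal_powDn L i j x y :
  ideal_pow L i x -> ideal_pow L j y -> ideal_pow L (i + j) (x * y).
Proof.
elim: i x => [|i IHi] x; first by move=> _; apply: ideal_powM.
move=> Lx Ly; move: x Lx; rewrite addSn; apply: ideal_gen_min => [|u v|a u|u].
- by rewrite mul0r; apply: ideal_pow0.
- by rewrite mulrDl; apply: ideal_powD.
- by rewrite -mulrA; apply: ideal_powM.
case=> a [b [La Lb ->]]; rewrite -mulrA; apply: ideal_gen_mem.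
by exists a, (b * y); split=> //; apply: IHi.
Qed.

End Ideals.

Section FiberCone.
Variables (K : fieldType) (n : nat).
Local Notation S := {mpoly K[n]}.
Implicit Types L : S -> Prop.

Definition irrelevant_ideal : S -> Prop :=
  ideal_gen (fun x => exists i : 'I_n, x = 'X_i).

(* The Rees algebra [\bigoplus_k L^k] as the subring [\bigoplus_k L^k t^k] of
   [S[t]]. *)
Definition rees L : {pred {poly S}} :=
  fun f => `[< forall k, ideal_pow L k f`_k >].

Lemma rees_subring_closed L : subring_closed (rees L).
Proof.
split=> [|f g /asboolP Lf /asboolP Lg|f g /asboolP Lf /asboolP Lg].
- apply/asboolP=> k; rewrite coef1; case: k => [//|k]; exact: ideal_pow0.
- apply/asboolP=> k; rewrite coefB -mulN1r.
  by apply: ideal_powD => //; apply: ideal_powM.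
- apply/asboolP=> k; rewrite coefM.
  elim/big_rec: _ => [|i x _ Lx]; first exact: ideal_pow0.
  apply: ideal_powD => //.
  by rewrite -[X in ideal_pow L X _](subnKC (_ : i <= k)%N) -1?ltnS //;
     apply: ideal_powDn.
Qed.

HB.instance Definition _ L :=
  GRing.isSubringClosed.Build {poly S} (rees L) (rees_subring_closed L).

Record rees_algebra L := ReesAlgebra {
  rees_val :> {poly S};
  rees_valP : rees_val \in rees L
}.

HB.instance Definition _ L := [isSub for @rees_val L].
HB.instance Definition _ L := [Choice of rees_algebra L by <:].
HB.instance Definition _ L :=
  [SubChoice_isSubComNzRing of rees_algebra L by <:].

(* The ideal [\bigoplus_k m L^k] of the Rees algebra. *)
Definition fiber_ideal L : {pred rees_algebra L} :=
  fun f => `[< forall k,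
    ideal_mul irrelevant_ideal (ideal_pow L k) (rees_val f)`_k >].

Lemma irrelevant_ideal_coef0 x : irrelevant_ideal x -> x@_0%MM = 0.
Proof.
pose I (x : S) := x@_0%MM = 0.
apply: (@ideal_gen_min _ _ I) => {x} [|x y xI yI|a x xI|x [i ->]]; rewrite /I.
- by rewrite mcoeff0.
- by rewrite mcoeffD xI yI addr0.
- by rewrite (rmorphM (mcoeff 0)) /= [x@_0%MM]xI mulr0.
- by rewrite mcoeffX mnm1_eq0.
Qed.

Lemma fiber_ideal_closed L : idealr_closed (@fiber_ideal L).
Proof.
split=> [||f g h /asboolP gI /asboolP hI].
- by apply/asboolP=> k; rewrite /= coef0; apply: ideal_gen0.
- apply/negP=> /asboolP/(_ 0%N); rewrite /= coef1 /= => H.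
  have: irrelevant_ideal (1 : S).
    move: H; apply: ideal_gen_min => [|x y|a x|x [a [b [aI _ ->]]]].
    + exact: ideal_gen0.
    + exact: ideal_genD.
    + exact: ideal_genM.
    + by rewrite mulrC; apply: ideal_genM.
  by move/irrelevant_ideal_coef0/eqP; rewrite mcoeff1 eqxx oner_eq0.
- apply/asboolP=> k; rewrite /= coefD; apply: ideal_genD; last exact: hI.
  rewrite coefM; apply: ideal_gen_sum => i _.
  have ik : (i <= k)%N by rewrite -ltnS.
  have /asboolP/(_ i) := rees_valP f; move: (gI (k - i)%N).
  move: (f : {poly S})`_i (g : {poly S})`_(k - i) => x y yI xL.
  move: y yI; apply: ideal_gen_min => [|u v|a u|u [a [b [aI bL ->]]]].
  + by rewrite mulr0; apply: ideal_gen0.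
  + by rewrite mulrDr; apply: ideal_genD.
  + by rewrite mulrCA; apply: ideal_genM.
  + rewrite mulrCA; apply: ideal_gen_mem; exists a, (x * b); split=> //.
    by rewrite -(subnKC ik); apply: ideal_powDn.
Qed.

HB.instance Definition _ L :=
  isIdealr.Build (rees_algebra L) (@fiber_ideal L) (fiber_ideal_closed L).

(* [\bigoplus_k L^k / m L^k], with its ring structure inherited from the Rees
   algebra. *)
Definition fiber_cone L : comNzRingType := {ideal_quot (@fiber_ideal L)}.

Definition analytic_spread L (l : nat) := krull_dim (fiber_cone L) l.

Definition equigenerated_monomial L :=
  exists (e : nat) (s : seq 'X_{1..n}),
    [/\ generates [seq 'X_[m] | m <- s] L,
        forall t, subseq t s -> generates [seq 'X_[m] | m <- t] L -> t = s
      & forall m, m \in s -> mdeg m = e].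

(* The equation is over [int]: subtraction on [nat] is truncated. *)
Definition freiman L :=
  equigenerated_monomial L /\
  exists mu mu2 l : nat,
    [/\ min_num_gens L mu, min_num_gens (ideal_pow L 2) mu2,
        analytic_spread L l
      & mu2%:Z = l%:Z * mu%:Z - 'C(l, 2)%:Z].

End FiberCone.

Section Hibi.
Variables (disp : Order.disp_t) (P : finPOrderType disp).

Definition is_chain (A : {set P}) := {in A &, forall p q, (p >=< q)%O}.

Definition poset_ideal (I : {set P}) :=
  forall p q : P, p \in I -> (q <= p)%O -> q \in I.

Variable K : fieldType.
Local Notation S := {mpoly K[#|{: P + P}|]}.

Definition hibi_x (p : P) : S := 'X_(enum_rank (inl p : P + P)%type).
Definition hibi_y (p : P) : S := 'X_(enum_rank (inr p : P + P)%type).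

Definition hibi_monomial (I : {set P}) : S :=
  (\prod_(p in I) hibi_x p) * (\prod_(p in ~: I) hibi_y p).

Definition hibi_ideal : S -> Prop :=
  ideal_gen (fun x => exists2 I, poset_ideal I & x = hibi_monomial I).

End Hibi.
Arguments hibi_ideal {disp} P K.

(* Main.v *)
Require Import Defs.
From HB Require Import structures.
From mathcomp Require Import all_boot all_order all_algebra zify.
From mathcomp Require Import boolp mpoly.

Set Implicit Arguments.
Unset Strict Implicit.
Unset Printing Implicit Defensive.

Import Order.TTheory GRing.Theory Num.Theory.

(** Write [n = #|P|], [N] for the number of poset ideals of [P], and [M] for the
    number of pairs [A \subset B] of poset ideals.

    The three numbers in the Freiman equation are [mu(H_P) = N],
    [mu(H_P^2) = M] and [l(H_P) = n + 1].  The generators of [H_P] and of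
    [H_P^2] are monomials of one degree, so they only have to be counted; since
    [u_I u_J = u_(I :&: J) u_(I :|: J)], each product of two generators is
    [u_A u_B] for exactly one nested pair ([hibi_square_gens]).

    The spread is computed directly from chains of primes.
    - At least [n + 1]: a linear extension of [P] gives ideals of [P] with
      [n, n - 1, ..., 0] elements, hence a flag of faces of the polytope of the
      exponents of the [u_I].  Killing the monomials off a face is a prime
      ideal of the fiber cone, and these together with the irrelevant ideal
      form a strict chain ([fiber_cone_prime_chain]).
    - At most [n + 1]: a monomial of degree [k n] in [H_P^k] is determined by
      its [x]-exponents, which lie between [0] and [k].  So the part of the
      fiber cone below degree [D] has dimension at most [D^(n+1)], and any
      [n + 2] elements satisfy a polynomial relation.  Choosing them along a
      longer chain of primes, one element in each step, contradicts such a
      relation, as its lexicographically least monomial shows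
      ([no_dependence], [prime_chain_bound]).

    It remains to see that [M = (n + 1) N - 'C(n + 1, 2)] exactly when some
    [P :\ p] is a chain.  Fix a linear extension [r] and let [I_0, ..., I_n] be
    its initial segments.  Joining an ideal [A] with the [I_j] and intersecting
    it with them gives a maximal chain of ideals through [A], hence [n] strict
    pairs containing [A].  Over all [A] this gives [n N] pairs, and the only
    repetitions are the ['C(n + 1, 2)] pairs of two initial segments
    ([card_steps], [steps_overlap]).  So [M >= (n + 1) N - 'C(n + 1, 2)], with
    equality if and only if every strict pair has the form [(A, A :|: I_j)] or
    [(B :&: I_j, B)] ([card_nested]).  This last condition says that the
    incomparable pairs of [P] have a point in common
    ([all_steps_of_chain], [no_chain_has_unreached_pair]). *)

(** * Counting nested pairs of poset ideals *)

Section Posets.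
Variables (disp : Order.disp_t) (P : finPOrderType disp).
Implicit Types (p q a b c u v w x y z : P) (A B I J : {set P}).

(** Locked so that rewriting with [in_set] leaves membership in it folded. *)
Definition ideals : {set {set P}} :=
  locked [set I | `[< poset_ideal I >]].

Lemma idealsP I : reflect (poset_ideal I) (I \in ideals).
Proof. by rewrite /ideals -lock inE; apply: asboolP. Qed.

Lemma poset_idealU I J :
  poset_ideal I -> poset_ideal J -> poset_ideal (I :|: J).
Proof.
move=> iI iJ p q; rewrite !inE => /orP[pI|pJ] qp.
  by rewrite (iI p q).
by rewrite (iJ p q) ?orbT.
Qed.

Lemma poset_idealI I J :
  poset_ideal I -> poset_ideal J -> poset_ideal (I :&: J).
Proof.
by move=> iI iJ p q; rewrite !inE => /andP[pI pJ] qp;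
  rewrite (iI p q) ?(iJ p q).
Qed.

Definition down_set a := [set q | (q <= a)%O].

Lemma poset_ideal_down a : poset_ideal (down_set a).
Proof. by move=> p q; rewrite !inE => pa qp; apply: le_trans pa. Qed.

Definition nested : {set {set P} * {set P}} :=
  [set AB | [&& AB.1 \in ideals, AB.2 \in ideals & AB.1 \subset AB.2]].

Definition linear_extension (r : P -> nat) :=
  injective r /\ {homo r : p q / (p < q)%O >-> (p < q)%N}.

(** Ordering first by the size of the principal ideal and then by the
    enumeration of [P] gives an injective monotone function; counting the
    elements below [p] for that order brings its values below [#|P|]. *)
Lemma linear_extension_exists :
  exists r : P -> nat, linear_extension r /\ forall p, (r p < #|P|)%N.
Proof.
pose s p := (#|down_set p| * #|P| + enum_rank p)%N.
have s_inj : injective s.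
  move=> p q /(congr1 (modn^~ #|P|)); rewrite /s !modnMDl !modn_small //.
  by move/val_inj/enum_rank_inj.
have s_homo : {homo s : p q / (p < q)%O >-> (p < q)%N}.
  move=> p q pq; have /proper_card : down_set p \proper down_set q.
    apply/properP; split; last by exists q; rewrite inE ?lexx // lt_geF.
    by apply/subsetP=> x; rewrite !inE => xp; apply: le_trans (ltW pq).
  move=> lt_pq; apply: (@leq_trans (#|down_set p|.+1 * #|P|)%N).
    by rewrite /s mulSn addnC ltn_add2r ltn_ord.
  by rewrite (leq_trans _ (leq_addr _ _)) // leq_mul2r lt_pq orbT.
have mono p q : (s p < s q)%N ->
    [set x | (s x < s p)%N] \proper [set x | (s x < s q)%N].
  move=> pq; apply/properP; split; last by exists p; rewrite inE ?ltnn.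
  by apply/subsetP=> x; rewrite !inE => /ltn_trans; apply.
exists (fun p => #|[set q | (s q < s p)%N]|); split; last first.
  move=> p; rewrite -cardsT; apply: proper_card; apply/properP.
  by split; [apply: subsetT | exists p; rewrite ?inE ?ltnn].
split=> [p q pq|p q /s_homo /mono /proper_card //].
case: (ltngtP (s p) (s q)) => [||/s_inj //] /mono/proper_card;
  by rewrite pq ltnn.
Qed.

Section Count.
Variable r : P -> nat.
Hypothesis r_ext : linear_extension r.

Let r_inj : injective r := r_ext.1.

Lemma linear_extension_le p q : (p <= q)%O -> (r p <= r q)%N.
Proof. by rewrite le_eqVlt => /orP[/eqP->//|/r_ext.2/ltnW]. Qed.

Lemma linear_extension_total p q : p != q -> (r p < r q)%N || (r q < r p)%N.
Proof. by rewrite -neq_ltn; apply: contra_neq; apply: r_inj. Qed.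

Lemma incomparable_total p q :
  ~~ (p >=< q)%O -> (r p < r q)%N || (r q < r p)%N.
Proof.
move=> pq; apply: linear_extension_total.
by apply: contraNneq pq => ->; apply: comparablexx.
Qed.

Definition before p := [set q | (r q < r p)%N].
Definition upto p := [set q | (r q <= r p)%N].

Lemma poset_ideal_before p : poset_ideal (before p).
Proof.
by move=> x y; rewrite !inE => xp /linear_extension_le yx;
  apply: leq_ltn_trans xp.
Qed.

Lemma poset_ideal_upto p : poset_ideal (upto p).
Proof.
by move=> x y; rewrite !inE => xp /linear_extension_le yx; apply: leq_trans xp.
Qed.

Definition strict_nested :=
  [set AB : {set P} * {set P} | (AB \in nested) && (AB.1 != AB.2)].

(** The pairs [A] below [A :|: I] with [I] an initial segment of [r].  Every
    such strict pair is obtained with [I = upto p] for exactly one [p] outside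
    [A], the [r]-largest element of the difference. *)
Definition initial_steps : {set {set P} * {set P}} :=
  [set (x.1, x.1 :|: upto x.2) | x in
     [set x : {set P} * P | (x.1 \in ideals) && (x.2 \notin x.1)]].

Definition final_steps : {set {set P} * {set P}} :=
  [set (x.1 :&: before x.2, x.1) | x in
     [set x : {set P} * P | (x.1 \in ideals) && (x.2 \in x.1)]].

(** Each ideal [A] starts [n - #|A|] initial steps and ends [#|A|] final ones. *)
Lemma card_steps : (#|initial_steps| + #|final_steps| = #|ideals| * #|P|)%N.
Proof.
rewrite !card_in_imset; first 1 last.
- move=> [B p] [B' q]; rewrite !inE /= => /andP[_ pB] /andP[_ qB'] [eAB eB].
  subst B'; congr (_, _); apply: r_inj; apply/eqP; rewrite eqn_leq.
  move/setP: eAB => e; have := e p; have := e q.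
  by rewrite !inE pB qB' /= !ltnn; case: ltngtP.
- move=> [A p] [A' q]; rewrite !inE /= => /andP[_ pA] /andP[_ qA'] [eA eAB].
  subst A'; congr (_, _); apply: r_inj; apply/eqP; rewrite eqn_leq.
  move/setP: eAB => e; have := e p; have := e q.
  by rewrite !inE (negPf pA) (negPf qA') /= !leqnn => -> <-.
rewrite -[#|P|]cardsT -cardsX.
rewrite -[RHS](cardsID [set x : {set P} * P | x.2 \in x.1]) addnC.
congr (_ + _)%N; apply: eq_card => x; rewrite !inE andbT //.
by rewrite andbC.
Qed.

Lemma steps_strict : initial_steps :|: final_steps \subset strict_nested.
Proof.
apply/subsetP=> AB; rewrite inE => /orP[] /imsetP[[A p]];
  rewrite in_set /= => /andP[Ai pA] -> {AB}; rewrite !in_set /=.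
- apply/andP; split.
    apply/and3P; split; [exact: Ai |  | exact: subsetUl].
    apply/idealsP; apply: poset_idealU; [exact/idealsP|exact: poset_ideal_upto].
  apply: contraNneq pA => ->; by rewrite !inE leqnn orbT.
- apply/andP; split.
    apply/and3P; split; [ | exact: Ai | exact: subsetIl].
    apply/idealsP; apply: poset_idealI;
      [exact/idealsP|exact: poset_ideal_before].
  apply: contraTneq pA => <-; by rewrite !inE ltnn andbF.
Qed.

Definition chain_pairs : {set {set P} * {set P}} :=
  [set (before x.1, upto x.2) | x in [set x : P * P | (r x.1 <= r x.2)%N]].

(** If [B = A :|: upto q] and [A = B :&: before p], then [p] does not come after
    [q], for otherwise [q] would lie in [A]; this forces both ideals to be
    initial segments. *)
Lemma steps_overlap : initial_steps :&: final_steps = chain_pairs.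
Proof.
have sub p q : (r p <= r q)%N -> before p \subset upto q.
  by move=> pq; apply/subsetP=> x; rewrite !inE => /ltnW xp;
    apply: leq_trans pq.
apply/setP=> -[A B]; rewrite inE; apply/andP/idP.
  case=> /imsetP[[A' q]]; rewrite in_set /= => /andP[_ qA] [eA' BE]; subst A'.
  case/imsetP=> -[B' p]; rewrite in_set /= => /andP[_ pB] [AE eB']; subst B'.
  have pq : (r p <= r q)%N.
    rewrite leqNgt; apply/negP=> qp; move/negP: qA; apply.
    by rewrite AE BE !inE qp leqnn orbT.
  have eA : A = before p.
    rewrite AE; apply/setIidPr; rewrite BE.
    exact: subset_trans (sub _ _ pq) (subsetUr _ _).
  apply/imsetP; exists (p, q); rewrite ?inE //=; congr (_, _) => //.
  by rewrite BE eA; apply/setUidPr/sub.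
case/imsetP=> -[p q]; rewrite inE /= => pq [-> ->]; split; apply/imsetP.
  exists (before p, q) => /=; last by congr (_, _); apply/esym/setUidPr/sub.
  rewrite in_set /=; apply/andP; split; last by rewrite inE -leqNgt.
  exact/idealsP/poset_ideal_before.
exists (upto q, p) => /=; last by congr (_, _); apply/esym/setIidPr/sub.
rewrite in_set /=; apply/andP; split; last by rewrite inE.
exact/idealsP/poset_ideal_upto.
Qed.

(** The relation [r p <= r q] and its converse cover [P * P] and meet in the
    diagonal, so twice their size is [n^2 + n]. *)
Lemma card_chain_pairs : #|chain_pairs| = 'C(#|P|.+1, 2).
Proof.
rewrite card_in_imset => [|[p q] [p' q']]; last first.
  move=> _ _ [/setP eb /setP eu]; congr (_, _); apply: r_inj; apply/eqP.
    by have := eb p; have := eb p'; rewrite !inE !ltnn; case: ltngtP.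
  by have := eu q; have := eu q'; rewrite !inE !leqnn; case: ltngtP.
pose D := [set x : P * P | (r x.1 <= r x.2)%N].
pose D' := [set x : P * P | (r x.2 <= r x.1)%N].
have sz_eq : #|D| = #|D'|.
  rewrite -(card_imset (mem D) (can_inj (@swap_pairK P P)));
    apply: eq_card => -[p q].
  apply/imsetP/idP=> [[[p' q'] D_x [-> ->]]|]; first by move: D_x; rewrite !inE.
  by rewrite inE /= => qp; exists (q, p); rewrite ?inE.
have DI : #|D :&: D'| = #|P|.
  rewrite -cardsT.
  rewrite -(card_imset (mem [set: P]) (_ : injective (fun p => (p, p)))).
    apply: eq_card => -[p q]; rewrite !inE /= -eqn_leq; apply/eqP/imsetP.
      by move/r_inj=> <-; exists p; rewrite ?inE.
    by case=> x _ [-> ->].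
  by move=> p q [].
have DU : D :|: D' = setT by apply/setP=> x; rewrite !inE leq_total.
have := cardsUI D D'; rewrite DU DI -sz_eq cardsT card_prod -/D bin2 /=; lia.
Qed.

(** The Freiman defect of [P] is the number of strict pairs that are no steps. *)
Lemma card_nested :
  (#|nested| + 'C(#|P|.+1, 2) = #|P|.+1 * #|ideals| +
     #|strict_nested :\: (initial_steps :|: final_steps)|)%N.
Proof.
have diag : #|[set AB in nested | AB.1 == AB.2]| = #|ideals|.
  rewrite -(card_imset (mem ideals) (_ : injective (fun A => (A, A)))).
    apply: eq_card => -[A B]; rewrite in_set in_set /=; apply/andP/imsetP.
      by case=> /and3P[Ai _ _] /eqP <-; exists A.
    by case=> C Ci [-> ->]; rewrite Ci subxx.
  by move=> A B [].
have strictE : #|nested| = (#|ideals| + #|strict_nested|)%N.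
  rewrite -diag -[LHS](cardsID [set AB | AB.1 == AB.2]); congr (_ + _)%N.
    by apply: eq_card => AB; rewrite !in_set.
  by apply: eq_card => AB; rewrite !in_set andbC.
have := cardsUI initial_steps final_steps.
rewrite steps_overlap card_chain_pairs card_steps strictE.
rewrite -[#|strict_nested|](cardsID (initial_steps :|: final_steps)).
rewrite (setIidPr steps_strict) mulSn (mulnC #|P|) => <-.
by move: #|_ :|: _| #|_ :\: _| 'C(_, _) #|ideals| => *; lia.
Qed.

(** The next two lemmas compare [r] on the three layers of a pair: [A],
    [B :\: A] and the complement of [B].  An initial step is a pair whose
    middle layer comes before the top one, a final step a pair whose middle
    layer comes after the bottom one. *)
Lemma initial_stepsP A B : (A, B) \in strict_nested ->
  reflect (forall b c, b \in B :\: A -> c \notin B -> (r b < r c)%N)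
    ((A, B) \in initial_steps).
Proof.
rewrite !in_set /= => /andP[/and3P[Ai Bi AB] neqAB].
apply: (iffP imsetP) => [[[A' p]]|late].
  rewrite in_set /= => /andP[_ pA] [<- ->] b c; rewrite !inE.
  by case: (b \in A) => //= bp; rewrite negb_or -ltnNge => /andP[_];
    apply: leq_ltn_trans.
have [b0 b0D] : exists b, b \in B :\: A.
  by apply/set0Pn; rewrite setD_eq0; rewrite eqEsubset AB in neqAB.
case: (@arg_maxnP _ b0 (mem (B :\: A)) r b0D) => p /setDP[pB pA] p_max.
exists (A, p); first by rewrite in_set /= Ai.
congr (_, _); apply/setP=> x; rewrite !inE; apply/idP/orP.
  move=> xB; case: (boolP (x \in A)) => xA; first by left.
  by right; apply: p_max; apply/setDP.
case=> [/(subsetP AB)//|xp]; apply: contraLR xp => xB; rewrite -ltnNge.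
by apply: late => //; rewrite inE pA.
Qed.

Lemma final_stepsP A B : (A, B) \in strict_nested ->
  reflect (forall a b, a \in A -> b \in B :\: A -> (r a < r b)%N)
    ((A, B) \in final_steps).
Proof.
rewrite !in_set /= => /andP[/and3P[Ai Bi AB] neqAB].
apply: (iffP imsetP) => [[[B' p]]|early].
  rewrite in_set /= => /andP[_ pB] [-> <-] a b; rewrite !inE => /andP[_ ap].
  by case: (b \in B); rewrite ?andbF //= andbT -leqNgt; apply: leq_trans.
have [b0 b0D] : exists b, b \in B :\: A.
  by apply/set0Pn; rewrite setD_eq0; rewrite eqEsubset AB in neqAB.
case: (@arg_minnP _ b0 (mem (B :\: A)) r b0D) => p /setDP[pB pA] p_min.
exists (B, p); first by rewrite in_set /= Bi.
congr (_, _); apply/setP=> x; rewrite !inE; apply/idP/andP.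
  by move=> xA; rewrite (subsetP AB) //; split=> //; apply: early;
    rewrite // inE pA.
case=> xB; apply: contraLR => xA; rewrite -leqNgt; apply: p_min.
exact/setDP.
Qed.

(** A pair that is no step has an inversion [c < b] between its top and middle
    layers and an inversion [b' < a] between its middle and bottom layers.  As
    the layers are cut out by ideals, inverted elements are incomparable, so
    both inversions contain the exceptional point [p].  Then [b = b' = p], and
    [c < p < a] makes [c] and [a] comparable, hence [c] an element of [A]. *)
Lemma all_steps_of_chain p : is_chain (~: [set p]) ->
  strict_nested \subset initial_steps :|: final_steps.
Proof.
move=> p_chain.
have cmp x y : x != p -> y != p -> (r x < r y)%N -> (x <= y)%O.
  move=> xp yp xy; have : (x >=< y)%O by apply: p_chain; rewrite !inE.
  by case/orP=> // /linear_extension_le; rewrite leqNgt xy.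
apply/subsetP=> -[A B] AB; rewrite in_setU.
case: (initial_stepsP AB) => //= not_late.
apply/(final_stepsP AB) => a b' aA b'D.
move: AB; rewrite !in_set /= => /andP[/and3P[/idealsP Ai /idealsP Bi AB] _].
move: b'D; rewrite inE => /andP[b'A b'B].
have /linear_extension_total/orP[//|b'a] : a != b'.
  by apply: contraNneq b'A => <-.
case: not_late => b c; rewrite inE => /andP[bA bB] cB.
have /linear_extension_total/orP[//|cb] : b != c by apply: contraNneq cB => <-.
have bp : (b == p) || (c == p).
  apply: contraT; rewrite negb_or => /andP[bp cp].
  by move/negP: cB; case; apply: Bi bB (cmp _ _ cp bp cb).
have b'p : (b' == p) || (a == p).
  apply: contraT; rewrite negb_or => /andP[b'p ap].
  by move/negP: b'A; case; apply: Ai aA (cmp _ _ b'p ap b'a).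
have aB := subsetP AB _ aA.
have ca : c != a by apply: contraNneq cB => ->.
have cb' : c != b' by apply: contraNneq cB => ->.
have ab : a != b by apply: contraNneq bA => <-.
have pE : b = p /\ b' = p.
  case/orP: bp => /eqP e1; case/orP: b'p => /eqP e2 //; subst p.
  - by rewrite e2 eqxx in ab.
  - by rewrite e2 eqxx in cb'.
  - by rewrite e2 eqxx in ca.
case: pE => e1 e2; subst b b'.
move/negP: cB; case; apply: (Bi a) => //; apply: cmp => //.
exact: ltn_trans cb b'a.
Qed.

Definition has_unreached_pair :=
  ~~ (strict_nested \subset initial_steps :|: final_steps).

(** Two inversions [b' < a] and [c < b] are realised by a nested pair, the ideal
    of [a] inside the ideal of [a], [b] and [b'], as soon as the order of [P]
    does not push the points into the wrong layers. *)
Lemma unreached_pair a b b' c :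
  (r b' < r a)%N -> (r c < r b)%N -> ~~ (b' <= a)%O -> ~~ (b <= a)%O ->
  ~~ (c <= a)%O -> ~~ (c <= b)%O -> ~~ (c <= b')%O ->
  has_unreached_pair.
Proof.
move=> b'a cb nb'a nba nca ncb ncb'.
pose A := down_set a; pose B := A :|: (down_set b :|: down_set b').
have AB : (A, B) \in strict_nested.
  rewrite !in_set /=; apply/andP; split; last first.
    by apply/eqP=> /setP/(_ b); rewrite !inE (negPf nba) lexx.
  apply/and3P; split; last exact: subsetUl.
    exact/idealsP/poset_ideal_down.
  by apply/idealsP; do 2?[apply: poset_idealU]; apply: poset_ideal_down.
apply/subsetPn; exists (A, B) => //; rewrite in_setU negb_or; apply/andP; split.
  apply/(initial_stepsP AB) => /(_ b c); rewrite !inE (negPf nba) lexx /=.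
  by rewrite (negPf nca) (negPf ncb) (negPf ncb') => /(_ isT isT);
    rewrite ltnNge ltnW.
apply/(final_stepsP AB) => /(_ a b'); rewrite !inE (negPf nb'a) !lexx /= !orbT.
by move=> /(_ isT isT); rewrite ltnNge ltnW.
Qed.

(** In an antichain one point serves as both [b] and [b']. *)
Lemma antichain_has_unreached_pair a b c :
  ~~ (a >=< b)%O -> ~~ (a >=< c)%O -> ~~ (b >=< c)%O -> has_unreached_pair.
Proof.
wlog lt_cb : a b c / (r c < r b < r a)%N.
  move=> th ab ac bc.
  have := incomparable_total ab; have := incomparable_total ac.
  have := incomparable_total bc.
  have [ba ca cb] : [/\ ~~ (b >=< a)%O, ~~ (c >=< a)%O & ~~ (c >=< b)%O].
    by split; rewrite comparable_sym.
  case/orP=> lt1; case/orP=> lt2; case/orP=> lt3; first [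
    by apply: (th a b c) => //; apply/andP
  | by apply: (th a c b) => //; apply/andP
  | by apply: (th b a c) => //; apply/andP
  | by apply: (th b c a) => //; apply/andP
  | by apply: (th c a b) => //; apply/andP
  | by apply: (th c b a) => //; apply/andP
  | by have := ltn_trans lt1 (ltn_trans lt3 lt2); rewrite ltnn
  | by have := ltn_trans lt1 (ltn_trans lt2 lt3); rewrite ltnn].
rewrite !negb_or => /andP[ab ba] /andP[ac ca] /andP[bc cb].
by case/andP: lt_cb => cb' ba'; apply: (@unreached_pair a b b c).
Qed.

(** With [u < v] and [w < z] for [r], either pair may provide the lower
    inversion, unless relations between the two pairs prevent it.  If
    [v <= z], then [{u, v}] can be the lower one unless [w <= u], and in that
    case [{w, v}] and [{u, z}] are suitable inversions; [z <= v] is symmetric.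
    If [v] and [z] are incomparable, both choices are excluded only by [u <= z]
    and [w <= v] together, and then [{u, w}] and [{v, z}] are suitable. *)
Lemma disjoint_pairs_have_unreached_pair u v w z :
  ~~ (u >=< v)%O -> ~~ (w >=< z)%O -> u != w -> u != z -> v != w -> v != z ->
  has_unreached_pair.
Proof.
have nle x y : x != y -> (x <= y)%O -> ~~ (y <= x)%O.
  by move=> xy lxy; apply: contra xy => lyx; rewrite eq_le lxy.
wlog lt_uv : u v / (r u < r v)%N.
  move=> th uv wz; have /orP[lt|lt] := incomparable_total uv;
    first exact: th lt uv wz.
  by move=> uw uz vw vz; apply: (th v u); rewrite // comparable_sym.
wlog lt_wz : w z / (r w < r z)%N.
  move=> th uv wz; have /orP[lt|lt] := incomparable_total wz;
    first exact: th lt uv wz.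
  by move=> uw uz vw vz; apply: (th z w); rewrite // comparable_sym.
rewrite !negb_or => /andP[uv vu] /andP[wz zw] uw uz vw vz.
(* The larger points being comparable: [w' <= u'] decides which pair of
   inversions to use. *)
have top_le u' v' w' z' : (r u' < r v')%N -> (r w' < r z')%N ->
    ~~ (u' <= v')%O -> ~~ (w' <= z')%O -> u' != z' -> u' != w' -> v' != z' ->
    (v' <= z')%O -> has_unreached_pair.
  move=> lt_uv' lt_wz' uv' wz' uz' uw' vz' le_vz.
  have nwv : ~~ (w' <= v')%O by apply: contra wz' => /le_trans; apply.
  have [wu|nwu] := boolP (w' <= u')%O; last first.
    by apply: (@unreached_pair v' z' u' w') => //; apply: nle.
  apply: (@unreached_pair v' z' w' u') => //.
  - exact: leq_ltn_trans (linear_extension_le wu) lt_uv'.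
  - exact: leq_trans lt_uv' (linear_extension_le le_vz).
  - exact: nle.
  - by apply: contra wz'; apply: le_trans.
  - by rewrite eq_sym in uw'; apply: nle.
have [le_vz|nvz] := boolP (v <= z)%O; first exact: (top_le u v w z).
have [le_zv|nzv] := boolP (z <= v)%O.
  by apply: (top_le w z u v); rewrite // 1?eq_sym.
have [le_uw|nuw] := boolP (u <= w)%O.
  have nwv : ~~ (w <= v)%O by apply: contra uv; apply: le_trans.
  apply: (@unreached_pair v z u w) => //; exact: nle.
have [le_uz|nuz] := boolP (u <= z)%O; last exact: (@unreached_pair z v w u).
have nwu : ~~ (w <= u)%O by apply: contra wz => /le_trans; apply.
have [le_wv|nwv] := boolP (w <= v)%O; last exact: (@unreached_pair v z u w).
have nvw : ~~ (v <= w)%O by apply: nle; rewrite // eq_sym.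
have nzu : ~~ (z <= u)%O by apply: nle.
have : (r u < r w)%N || (r w < r u)%N.
  by apply: incomparable_total; rewrite negb_or nuw.
have : (r v < r z)%N || (r z < r v)%N.
  by apply: incomparable_total; rewrite negb_or nvz.
case/orP=> lt1; case/orP=> lt2.
- exact: (@unreached_pair w z u v).
- exact: (@unreached_pair u z w v).
- exact: (@unreached_pair w v u z).
- exact: (@unreached_pair u v w z).
Qed.

(** The incomparability graph has no vertex meeting all edges, so it contains a
    triangle or two disjoint edges. *)
Lemma no_chain_has_unreached_pair : (0 < #|P|)%N ->
  (forall p, ~ is_chain (~: [set p])) -> has_unreached_pair.
Proof.
move=> /card_gt0P[p0 _] no_chain.
have pair p : exists x y, [/\ x != p, y != p & ~~ (x >=< y)%O].
  apply: contrapT => no_pair; apply: (no_chain p) => x y.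
  rewrite !inE => xp yp; apply: contrapT => /negP xy.
  by apply: no_pair; exists x, y.
have [u [v [_ _ uv]]] := pair p0.
have neq_inc x y : ~~ (x >=< y)%O -> x != y.
  by apply: contraNneq => ->; apply: comparablexx.
have [v' [w [v'u wu v'w]]] := pair u.
have [u' [w' [u'v w'v u'w']]] := pair v.
have [eq1|nv'] := boolP ((v' == v) || (w == v)); last first.
  move: nv'; rewrite negb_or => /andP[? ?].
  by apply: (disjoint_pairs_have_unreached_pair uv v'w); rewrite // eq_sym.
have [eq2|nu'] := boolP ((u' == u) || (w' == u)); last first.
  move: nu'; rewrite negb_or => /andP[? ?].
  by apply: (disjoint_pairs_have_unreached_pair uv u'w'); rewrite // eq_sym.
(* The edges [{u, v}], [{v, x}] and [{u, y}]: a triangle if [x = y], and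
   otherwise the last two are disjoint. *)
have [x [xu vx]] : exists x, x != u /\ ~~ (v >=< x)%O.
  case/orP: eq1 => /eqP e; subst v; first by exists w.
  by exists v'; rewrite comparable_sym.
have [y [yv uy]] : exists y, y != v /\ ~~ (u >=< y)%O.
  case/orP: eq2 => /eqP e; subst u; first by exists w'.
  by exists u'; rewrite comparable_sym.
have [exy|xy] := eqVneq x y.
  by subst y; apply: (antichain_has_unreached_pair uv uy vx).
apply: (disjoint_pairs_have_unreached_pair vx uy); rewrite // 1?eq_sym //;
  exact: neq_inc.
Qed.

End Count.

Lemma card_nested_eqP : (0 < #|P|)%N ->
  (#|nested| + 'C(#|P|.+1, 2) = #|P|.+1 * #|ideals|)%N <->
  exists p : P, is_chain (~: [set p]).
Proof.
move=> P_gt0; have [r [r_ext _]] := linear_extension_exists.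
rewrite (card_nested r_ext); split=> [/eqP|[p p_chain]].
  rewrite -[X in _ == X]addn0 eqn_add2l cards_eq0 setD_eq0 => sub.
  apply: contrapT => no_chain.
  suff: has_unreached_pair r by rewrite /has_unreached_pair sub.
  by apply: no_chain_has_unreached_pair => // p pP; apply: no_chain; exists p.
have := all_steps_of_chain r_ext p_chain.
by rewrite -setD_eq0 -cards_eq0 => /eqP ->; rewrite addn0.
Qed.

End Posets.

(** * Monomial ideals and their minimal generators *)

Section MonomialIdeals.
Local Open Scope ring_scope.
Variables (K : fieldType) (n : nat).
Local Notation S := {mpoly K[n]}.
Implicit Types (G : 'X_{1..n} -> Prop) (m g : 'X_{1..n}) (f : S).

Definition monomial_ideal G : S -> Prop :=
  ideal_gen (fun x => exists2 m, G m & x = 'X_[m]).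

Fixpoint sums_of G k m : Prop :=
  if k is k'.+1 then exists a b, [/\ G a, sums_of G k' b & m = (a + b)%MM]
  else m = 0%MM.

(** A property of exponents that is stable under multiplication is inherited by
    the supports of all elements of an ideal from those of its generators. *)
Lemma ideal_gen_supp (A : S -> Prop) (Q : 'X_{1..n} -> Prop) f :
  (forall m m', (m <= m')%MM -> Q m -> Q m') ->
  (forall x, A x -> forall m, m \in msupp x -> Q m) ->
  ideal_gen A f -> forall m, m \in msupp f -> Q m.
Proof.
move=> Q_up AQ.
apply: (@ideal_gen_min _ A (fun f => forall m, m \in msupp f -> Q m)) => //.
- by move=> m; rewrite msupp0.
- by move=> x y xQ yQ m /msuppD_le; rewrite mem_cat => /orP[/xQ|/yQ].
move=> a x xQ m /msuppM_le /allpairsP[[m1 m2] /= [_ m2x ->]].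
exact: Q_up (lem_addl _ _) (xQ _ m2x).
Qed.

Lemma monomial_ideal_supp G f m :
  monomial_ideal G f -> m \in msupp f -> exists2 g, G g & (g <= m)%MM.
Proof.
move=> Lf; move: m; apply: (ideal_gen_supp _ _ Lf) =>
  [m m' mm' [g Gg gm]|x [g Gg ->] m].
  by exists g => //; apply: lepm_trans mm'.
by move/mem_msuppXP=> <-; exists g; rewrite ?lepm_refl.
Qed.

Lemma ideal_pow_supp G k f m : ideal_pow (monomial_ideal G) k f ->
  m \in msupp f -> exists2 g, sums_of G k g & (g <= m)%MM.
Proof.
elim: k f m => [|k IHk] f m.
  by exists 0%MM => //; apply/mnm_lepP=> i; rewrite mnm0E.
move=> Lf; move: m; apply: (ideal_gen_supp _ _ Lf) =>
  [m m' mm' [g Gg gm]|x [a [b]]].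
  by exists g => //; apply: lepm_trans mm'.
case=> La Lb -> m /msuppM_le /allpairsP[[m1 m2] /= [m1a m2b ->]].
have [g1 Gg1 le1] := monomial_ideal_supp La m1a.
have [g2 Gg2 le2] := IHk _ _ Lb m2b.
exists (g1 + g2)%MM; first by exists g1, g2.
by apply/mnm_lepP=> i; rewrite !mnmDE leq_add // (mnm_lepP _ _).
Qed.

Lemma monomial_ideal_X G m : G m -> monomial_ideal G 'X_[m].
Proof. by move=> Gm; apply: ideal_gen_mem; exists m. Qed.

Lemma ideal_pow_X G k m :
  sums_of G k m -> ideal_pow (monomial_ideal G) k 'X_[m].
Proof.
elim: k m => // k IHk _ [a [b [Ga Gb ->]]]; rewrite mpolyXD.
apply: ideal_gen_mem; exists 'X_[a], 'X_[b]; split=> //; last exact: IHk.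
exact: monomial_ideal_X.
Qed.

Lemma mpoly_ind_supp (Q : S -> Prop) f : Q 0 ->
  (forall x y, Q x -> Q y -> Q (x + y)) ->
  (forall m, m \in msupp f -> Q (f@_m *: 'X_[m])) -> Q f.
Proof.
move=> Q0 QD QX; rewrite [f]mpolyE big_seq; elim/big_ind: _ => //.
Qed.

Lemma scaleX_factor c m g : (g <= m)%MM ->
  c *: 'X_[m] = (c *: 'X_[m - g]) * 'X_[g] :> S.
Proof. by move=> gm; rewrite -scalerAl -mpolyXD submK. Qed.

Lemma ideal_powE G k : ideal_pow (monomial_ideal G) k =
  monomial_ideal (sums_of G k).
Proof.
apply/funext=> f; apply/propext; split=> [Lf|].
  apply: mpoly_ind_supp; first exact: ideal_gen0.
    exact: ideal_genD.
  move=> m /(ideal_pow_supp Lf)[g Gg gm]; rewrite (scaleX_factor _ gm).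
  exact/ideal_genM/monomial_ideal_X.
apply: ideal_gen_min => [|||x [m Gm ->]]; last exact: ideal_pow_X.
- exact: ideal_pow0.
- exact: ideal_powD.
- exact: ideal_powM.
Qed.

Lemma mdeg_le m1 m2 : (m1 <= m2)%MM -> (mdeg m1 <= mdeg m2)%N.
Proof. by move/mnm_lepP=> le12; rewrite !mdegE leq_sum. Qed.

(** In lowest degree, multiplication by [a] only sees the constant term of [a]. *)
Lemma mcoeffM_low e a f m : (forall m', m' \in msupp f -> (e <= mdeg m')%N) ->
  mdeg m = e -> (a * f)@_m = a@_0%MM * f@_m.
Proof.
move=> f_low m_e; apply/eqP; rewrite -mcoeffCM -subr_eq0 -mcoeffB -mulrBl.
rewrite mcoeff_eq0; apply/negP=> /msuppM_le /allpairsP[[m1 m2] /= [m1a m2f mE]].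
move: m_e; rewrite mE mdegD; have := f_low _ m2f.
suff : mdeg m1 != 0%N by lia.
rewrite mdeg_eq0; apply: contraTneq m1a => ->.
by rewrite mcoeff_msupp mcoeffB mcoeffC eqxx mulr1 subrr eqxx.
Qed.

Lemma generates_monomials (s : seq 'X_{1..n}) :
  generates [seq 'X_[m] | m <- s] (monomial_ideal (fun m => m \in s)).
Proof.
rewrite /generates /monomial_ideal => x.
suff -> : (fun x : S => exists2 m, m \in s & x = 'X_[m]) =
          (fun y => y \in [seq 'X_[m] | m <- s]) by [].
by apply/funext=> y; apply/propext; split=> /mapP.
Qed.

(** Writing the monomials in terms of [t] and comparing coefficients in the
    lowest degree [e] factors the identity matrix of size [size s] through a
    space of dimension [size t]. *)
Lemma monomial_gens_minimal e (s : seq 'X_{1..n}) (t : seq S) :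
  uniq s -> (forall m, m \in s -> mdeg m = e) ->
  generates t (monomial_ideal (fun m => m \in s)) -> (size s <= size t)%N.
Proof.
move=> s_uniq s_e t_gen.
have t_low c : c \in t -> forall m, m \in msupp c -> (e <= mdeg m)%N.
  move=> ct m mc; have Lc : monomial_ideal (fun m => m \in s) c.
    by apply/t_gen/ideal_gen_mem.
  by have [g gs /mdeg_le] := monomial_ideal_supp Lc mc; rewrite (s_e g gs).
have /choice[cs csP] : forall i : 'I_(size s), exists cs : seq (S * S),
    (forall c, c \in cs -> c.2 \in t) /\
    'X_[nth 0%MM s i] = \sum_(c <- cs) c.1 * c.2.
  move=> i; have /t_gen[cs ct ->] : monomial_ideal (fun m => m \in s)
    'X_[nth 0%MM s i] by apply: monomial_ideal_X; apply: mem_nth.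
  by exists cs.
pose A := \matrix_(i < size s, j < size t)
  \sum_(c <- cs i | index c.2 t == j) c.1@_0%MM.
pose B := \matrix_(j < size t, i < size s) (nth 0 t j)@_(nth 0%MM s i).
suff : A *m B = 1%:M by apply: mulmx1_min.
apply/matrixP=> i i'; rewrite !mxE.
have [ct X_i] := csP i.
transitivity ('X_[nth 0%MM s i] : S)@_(nth 0%MM s i'); last first.
  by rewrite mcoeffX nth_uniq.
have s_i' : mdeg (nth 0%MM s i') = e by apply/s_e/mem_nth.
rewrite X_i raddf_sum /= [RHS]big_seq.
transitivity (\sum_(c <- cs i | c \in cs i)
    \sum_(j < size t | index c.2 t == j) c.1@_0%MM * c.2@_(nth 0%MM s i')).
  rewrite [RHS](exchange_big_dep xpredT) //=; apply: eq_bigr => j _.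
  rewrite !mxE mulr_suml big_seq_cond; apply: eq_bigr => c /andP[c_in /eqP <-].
  by rewrite nth_index ?ct.
apply: eq_bigr => c c_in;
  have lt_c : (index c.2 t < size t)%N by rewrite index_mem ct.
rewrite (big_pred1 (Ordinal lt_c)) //.
by rewrite (mcoeffM_low _ (t_low _ (ct _ c_in)) s_i').
Qed.

Lemma min_num_gens_monomial e (s : seq 'X_{1..n}) :
  uniq s -> (forall m, m \in s -> mdeg m = e) ->
  min_num_gens (monomial_ideal (fun m => m \in s)) (size s).
Proof.
move=> s_uniq s_e; split; last first.
  by move=> t; apply: monomial_gens_minimal s_uniq s_e.
exists [seq 'X_[m] | m <- s]; first by rewrite size_map.
exact: generates_monomials.
Qed.

Lemma equigenerated_monomial_ideal e (s : seq 'X_{1..n}) :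
  uniq s -> (forall m, m \in s -> mdeg m = e) ->
  equigenerated_monomial (monomial_ideal (fun m => m \in s)).
Proof.
move=> s_uniq s_e; exists e, s; split=> // [|t ts t_gen].
  exact: generates_monomials.
apply/eqP; rewrite -(size_subseq_leqif ts) eqn_leq size_subseq //=.
by have := monomial_gens_minimal s_uniq s_e t_gen; rewrite size_map.
Qed.

End MonomialIdeals.

Lemma min_num_gens_unique (R : comNzRingType) (L : R -> Prop) m m' :
  min_num_gens L m -> min_num_gens L m' -> m = m'.
Proof.
move=> [[s <- s_gen] s_min] [[t <- t_gen] t_min].
by apply/eqP; rewrite eqn_leq s_min // t_min.
Qed.

(** * Chains of primes in the fiber cone *)

Section FaceWeight.
Variables (n : nat) (D : {set 'I_n}).

(** Among exponents of the degree of the generators, [face_weight D] is minimal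
    on the face where the variables in [D] do not occur. *)
Definition face_weight (m : 'X_{1..n}) := (mdeg m + \sum_(i in D) m i)%N.

Lemma face_weight0 : face_weight 0%MM = 0%N.
Proof. by rewrite /face_weight mdeg0 big1 // => i _; rewrite mnm0E. Qed.

Lemma face_weightD : {morph face_weight : a b / (a + b)%MM >-> (a + b)%N}.
Proof.
move=> a b; rewrite /face_weight mdegD addnACA -big_split /=; congr (_ + _)%N.
by apply: eq_bigr => i _; rewrite mnmDE.
Qed.

HB.instance Definition _ :=
  isMeasure.Build n face_weight face_weight0 face_weightD.

End FaceWeight.

Section Primes.
Local Open Scope ring_scope.
Local Open Scope quotient_scope.
Variables (K : fieldType) (n : nat).
Local Notation S := {mpoly K[n]}.

Section InitialForms.
Variable w : measure n.

Lemma mcoeff_pihomog d (f : S) m :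
  (pihomog w d f)@_m = if w m == d then f@_m else 0.
Proof.
case: ifPn => wm; last by rewrite (dhomog_nemf_coeff (pihomogP w d f)).
rewrite pihomogE raddf_sum /= [in RHS](mpolyE f) raddf_sum /=.
rewrite [RHS](bigID (fun k => w k == d)) /= [X in _ + X]big1 ?addr0 // => k wk.
rewrite mcoeffZ mcoeffX; case: (eqVneq k m) wk => [->|_ _];
  last by rewrite mulr0.
by rewrite wm.
Qed.

(** Lowest forms multiply. *)
Lemma pihomogM_low d1 d2 (f g : S) :
  (forall m, m \in msupp f -> (d1 <= w m)%N) ->
  (forall m, m \in msupp g -> (d2 <= w m)%N) ->
  pihomog w (d1 + d2) (f * g) = pihomog w d1 f * pihomog w d2 g.
Proof.
move=> f_low g_low; set pf := pihomog w d1 f; set pg := pihomog w d2 g.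
have gt_low d (h : S) m : (forall m, m \in msupp h -> (d <= w m)%N) ->
    m \in msupp (h - pihomog w d h) -> (d < w m)%N.
  move=> h_low; rewrite mcoeff_msupp mcoeffB mcoeff_pihomog.
  have [wm|wm] := eqVneq (w m) d; first by rewrite subrr eqxx.
  by rewrite subr0 -mcoeff_msupp ltn_neqAle eq_sym wm => /h_low.
apply/mpolyP=> m; rewrite mcoeff_pihomog; case: eqP => [wm|/eqP wm]; last first.
  by rewrite (dhomog_nemf_coeff (dhomogM (pihomogP w d1 f) (pihomogP w d2 g))).
apply/eqP; rewrite -subr_eq0 -mcoeffB.
have -> : f * g - pf * pg = (f - pf) * g + pf * (g - pg).
  by rewrite mulrBl mulrBr addrA subrK.
have no_supp x : (forall m', m' \in msupp x -> (d1 + d2 < w m')%N) -> x@_m = 0.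
  by move=> x_gt; apply/eqP; rewrite mcoeff_eq0; apply/negP=> /x_gt;
    rewrite wm ltnn.
rewrite mcoeffD !no_supp ?addr0 //.
  move=> _ /msuppM_le /allpairsP[[a b] /= [ap /(gt_low _ _ _ g_low) bg ->]].
  rewrite mfD -addnS leq_add //.
  move: ap; rewrite mcoeff_msupp mcoeff_pihomog;
    case: (eqVneq (w a) d1) => [<-//|_].
  by rewrite eqxx.
move=> _ /msuppM_le /allpairsP[[a b] /= [af /g_low bg ->]].
have {}af := gt_low _ _ _ f_low af.
by rewrite mfD -addSn leq_add.
Qed.

Variable c : nat.

(** The part of [F] on the face [w = c * k].  When no exponent of [L^k] has
    weight below [c * k], it is a lowest form in each degree, so taking it is a
    ring morphism on the Rees algebra with values in a domain. *)
Definition initial_form (F : {poly S}) : {poly S} :=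
  \poly_(k < size F) pihomog w (c * k) F`_k.

Lemma coef_initial_form F k : (initial_form F)`_k = pihomog w (c * k) F`_k.
Proof.
rewrite coef_poly; case: ltnP => // le_k.
by rewrite nth_default // raddf0.
Qed.

Lemma initial_formB : {morph initial_form : F H / F - H}.
Proof.
by move=> F H; apply/polyP=> k; rewrite coefB !coef_initial_form coefB raddfB.
Qed.

Lemma initial_formD : {morph initial_form : F H / F + H}.
Proof.
by move=> F H; apply/polyP=> k; rewrite coefD !coef_initial_form coefD raddfD.
Qed.

Lemma initial_form1 : initial_form 1 = 1.
Proof.
apply/polyP=> k; rewrite coef_initial_form coef1; case: eqP => [->|_] /=.
  by rewrite muln0 pihomog_dE // dhomog1.
by rewrite mulr0n raddf0.
Qed.

Lemma initial_form_eq0 F :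
  initial_form F = 0 <-> (forall k m, w m = (c * k)%N -> F`_k@_m = 0).
Proof.
split=> [F0 k m wm|F0].
  have := congr1 (fun H : {poly S} => H`_k@_m) F0.
  by rewrite /= coef_initial_form coef0 mcoeff0 mcoeff_pihomog wm eqxx.
apply/polyP=> k; rewrite coef_initial_form coef0; apply/mpolyP=> m.
by rewrite mcoeff_pihomog mcoeff0; case: eqP => // /F0.
Qed.

Variables (G : 'X_{1..n} -> Prop).
Hypothesis G_low : forall g, G g -> (c <= w g)%N.
Hypothesis w_mdeg : forall m, (mdeg m <= w m)%N.

Local Notation L := (monomial_ideal (K := K) G).

Lemma ideal_pow_low k f m :
  ideal_pow L k f -> m \in msupp f -> (c * k <= w m)%N.
Proof.
move=> Lf /(ideal_pow_supp Lf)[g Gg gm].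
rewrite -(submK gm) mfD; apply: leq_trans (leq_addl _ _).
elim: k g Gg {gm Lf} => [g _|k IHk _ [a [b [Ga Gb ->]]]];
  first by rewrite muln0.
by rewrite mfD mulnS leq_add ?G_low ?IHk.
Qed.

Lemma rees_coef (F : rees_algebra L) k : ideal_pow L k (F : {poly S})`_k.
Proof. by have /asboolP := rees_valP F; apply. Qed.

Lemma initial_formM (F H : rees_algebra L) :
  initial_form (F * H : {poly S}) = initial_form F * initial_form H.
Proof.
apply/polyP=> k; rewrite coef_initial_form !coefM raddf_sum /=.
apply: eq_bigr => i _; rewrite !coef_initial_form.
have {1}-> : (c * k = c * i + c * (k - i))%N by rewrite -mulnDr subnKC // -ltnS.
by apply: pihomogM_low => m; apply: ideal_pow_low; apply: rees_coef.
Qed.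

(** Multiplication by a variable strictly increases the weight. *)
Lemma initial_form_fiber_ideal (F : rees_algebra L) :
  F \in fiber_ideal (L := L) -> initial_form F = 0.
Proof.
move=> /asboolP F_fib; apply/initial_form_eq0=> k m wm; apply/eqP.
rewrite mcoeff_eq0; apply/negP=> mF.
suff : (c * k < w m)%N by rewrite wm ltnn.
move: m mF {wm}; apply: (ideal_gen_supp _ _ (F_fib k)) =>
  [m m' mm' lt_m|x [a [b [aI Lb ->]]] m].
  by rewrite -(submK mm') mfD; apply: leq_trans (leq_addl _ _).
case/msuppM_le/allpairsP=> -[m1 m2] /= [m1a m2b ->]; rewrite mfD -add1n.
apply: leq_add; last exact: ideal_pow_low Lb m2b.
apply: leq_trans (w_mdeg _); rewrite lt0n mdeg_eq0.
by apply: contraTneq m1a => ->;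
  rewrite mcoeff_msupp (irrelevant_ideal_coef0 aI) eqxx.
Qed.

Local Notation pi_fiber := (\pi_({ideal_quot (@fiber_ideal _ _ L)})).

(** The kernel of [initial_form] on the fiber cone; it does not depend on the
    representatives by [initial_form_fiber_ideal]. *)
Definition face_prime : {pred fiber_cone L} :=
  fun x => initial_form (repr x : rees_algebra L) == 0.

Lemma face_prime_pi (F : rees_algebra L) :
  (pi_fiber F \in face_prime) = (initial_form F == 0).
Proof.
rewrite /face_prime unfold_in.
suff : initial_form F - initial_form (repr (pi_fiber F)) = 0.
  by move/eqP; rewrite subr_eq0 => /eqP ->.
rewrite -initial_formB.
rewrite -[_ - _]/(rees_val (F - repr (pi_fiber F))).
apply: initial_form_fiber_ideal.
by rewrite Quotient.idealrBE reprK.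
Qed.

Lemma face_prime_prime : prime_ideal face_prime.
Proof.
split; last first.
  move=> u v; rewrite -[u]reprK -[v]reprK -rmorphM !face_prime_pi.
  by rewrite initial_formM mulf_eq0.
split=> [||a u v].
- rewrite -(rmorph0 pi_fiber) face_prime_pi; apply/eqP/initial_form_eq0=> k m _.
  by rewrite coef0 mcoeff0.
- by rewrite -(rmorph1 pi_fiber) face_prime_pi initial_form1 oner_eq0.
rewrite -[a]reprK -[u]reprK -[v]reprK -rmorphM -rmorphD !face_prime_pi.
by move=> /eqP u0 /eqP v0;
  rewrite /= initial_formD initial_formM u0 v0 mulr0 addr0.
Qed.

End InitialForms.

Lemma face_weight_low (D : {set 'I_n}) m : (mdeg m <= face_weight D m)%N.
Proof. exact: leq_addr. Qed.

Section FaceChain.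
Variables (G : 'X_{1..n} -> Prop) (e l : nat).
Variables (D : nat -> {set 'I_n}) (g : nat -> 'X_{1..n}).
Hypothesis e_gt0 : (0 < e)%N.
Hypothesis G_e : forall m, G m -> mdeg m = e.
Hypothesis D_sub : forall i, (i < l)%N -> D i \subset D i.+1.
Hypothesis Gg : forall i, (i <= l)%N -> G (g i).
Hypothesis g_in : forall i, (i <= l)%N -> forall j, j \in D i -> g i j = 0%N.
Hypothesis g_out :
  forall i, (i < l)%N -> exists2 j, j \in D i.+1 & g i j <> 0%N.

Local Notation L := (monomial_ideal (K := K) G).
Local Notation pi_fiber := (\pi_({ideal_quot (@fiber_ideal _ _ L)})).

Let G_low (E : {set 'I_n}) c :
  (c <= e)%N -> forall m, G m -> (c <= face_weight E m)%N.
Proof.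
by move=> ce m Gm; rewrite (leq_trans ce) // -(G_e Gm) face_weight_low.
Qed.

Let rees_g (i : nat) (il : (i <= l)%N) : ('X_[g i])%:P * 'X \in rees L.
Proof.
apply/asboolP=> k; rewrite coefMX; case: k => [|[|k]] //=.
  rewrite coefC /=; have -> : 'X_[g i] = 'X_[g i] * 1 :> S by rewrite mulr1.
  apply: ideal_gen_mem; exists 'X_[g i], 1; split=> //.
  exact/monomial_ideal_X/Gg.
by rewrite coefC; apply: ideal_gen0.
Qed.

Let initial_form_g (w : measure n) c i :
  initial_form w c (('X_[g i] : S)%:P * 'X) = 0 <-> w (g i) <> c.
Proof.
rewrite initial_form_eq0; split=> [/(_ 1%N (g i)) + wg|wg k m wm].
  by rewrite wg muln1 coefMX coefC /= mcoeffX eqxx => /(_ erefl)/eqP;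
    rewrite oner_eq0.
rewrite coefMX; case: k wm => [|[|k]] wm /=;
  rewrite ?mcoeff0 // coefC /= ?mcoeff0 //.
by rewrite mcoeffX; case: eqP => // e_m; case: wg; rewrite e_m wm muln1.
Qed.

(** The faces decrease as [D i] grows, so the kernels increase, and the
    generator [g i] is a witness that the [i]-th step is strict.  The last prime
    is the ideal of elements without constant term.  It is also of the form
    [face_prime]: for the degree as weight and the slope [e.-1], the exponents
    of [L^k] lie off the face unless [k = 0]. *)
Lemma fiber_cone_prime_chain : prime_chain (fiber_cone L) l.+1.
Proof.
pose p i := if (i <= l)%N then face_prime (face_weight (D i)) e (G := G)
            else face_prime (face_weight set0) e.-1 (G := G).
have p_form (w : measure n) c (F : rees_algebra L) :
    (forall m, G m -> (c <= w m)%N) -> (forall m, (mdeg m <= w m)%N) ->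
    (pi_fiber F \in face_prime w c (G := G)) = (initial_form w c F == 0).
  by move=> G_w w_m; apply: face_prime_pi.
exists p; split=> [i _|i].
  rewrite /p; case: ifP => _; apply: face_prime_prime;
    by [apply: face_weight_low | apply: G_low; rewrite ?leq_pred].
rewrite ltnS => il; rewrite /p il.
have pi_g := p_form _ _ (ReesAlgebra (rees_g il)).
move: pi_g; set f := pi_fiber _ => pi_g.
have f_i : f \notin face_prime (face_weight (D i)) e (G := G).
  rewrite pi_g; [|exact: G_low|exact: face_weight_low].
  apply/eqP/initial_form_g; apply; rewrite /= /face_weight (G_e (Gg il)).
  by rewrite big1 ?addn0 // => j; apply: g_in.
have low (F : rees_algebra L) k m :
    m \in msupp (rees_val F)`_k -> (e * k <= mdeg m)%N.
  move=> mF; apply: (ideal_pow_low (w := mdeg) _ (rees_coef F k) mF) => a Ga /=.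
  by rewrite G_e.
case: ltnP => il'; split.
- move=> x; rewrite -[x]reprK !p_form; try exact: face_weight_low;
  try exact: G_low.
  move=> /eqP/initial_form_eq0 x0; apply/eqP/initial_form_eq0=> k m wm;
    apply/eqP.
  rewrite mcoeff_eq0; apply/negP=> mx; have := mx;
    rewrite mcoeff_msupp x0 ?eqxx //.
  apply/eqP; rewrite eqn_leq; apply/andP; split; last first.
    exact: leq_trans (low _ _ _ mx) (face_weight_low _ _).
  rewrite -wm /= leq_add2l.
  rewrite [X in (_ <= X)%N](big_setID (D i)) /= (setIidPr (D_sub il')).
  exact: leq_addr.
- move=> sub; move/negP: f_i; case; apply: sub.
  rewrite pi_g; [|exact: G_low|exact: face_weight_low].
  apply/eqP/initial_form_g; rewrite /= /face_weight (G_e (Gg il)).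
  have [j jD gj] := g_out il'.
  by rewrite (bigD1 j) //=; lia.
- move=> x; rewrite -[x]reprK !p_form; try exact: face_weight_low;
    try exact: G_low; last by apply: G_low; apply: leq_pred.
  move=> /eqP/initial_form_eq0 x0; apply/eqP/initial_form_eq0=> k m wm;
    apply/eqP.
  (* Only [k = 0] and the constant term are compatible with the slope [e.-1]. *)
  rewrite mcoeff_eq0; apply/negP=> mx; have := low _ _ _ mx.
  move: wm; rewrite /= /face_weight big_set0 addn0 => wm; rewrite wm => le_k.
  have k0 : k = 0%N by nia.
  have m0 : m = 0%MM by apply/eqP; rewrite -mdeg_eq0 wm k0 muln0.
  by move: mx; rewrite mcoeff_msupp x0 ?eqxx // m0 k0 muln0; apply: mf0.
- move=> sub; move/negP: f_i; case; apply: sub.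
  rewrite pi_g; [|by apply: G_low; apply: leq_pred|exact: face_weight_low].
  apply/eqP/initial_form_g; rewrite /= /face_weight (G_e (Gg il)) big_set0; lia.
Qed.

End FaceChain.
End Primes.

(** * An upper bound for the length of chains of primes *)

Section FiniteLinearAlgebra.
Local Open Scope ring_scope.

Lemma exists_left_kernel (K : fieldType) (I J : finType) (A : I -> J -> K) :
  (#|J| < #|I|)%N ->
  exists c : I -> K, (exists i, c i != 0) /\
    forall j, \sum_i c i * A i j = 0.
Proof.
move=> lt_JI.
pose M := \matrix_(i < #|I|, j < #|J|) A (enum_val i) (enum_val j).
have /rowV0Pn[v v_ker v_neq0] : kermx M != 0.
  rewrite kermx_eq0 /row_free neq_ltn.
  by rewrite (leq_ltn_trans (rank_leq_col M)).
exists (fun i => v 0 (enum_rank i)); split.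
  have [i vi] : exists i, v 0 i != 0.
    apply: contrapT => v0; case/eqP: v_neq0; apply/rowP=> i; rewrite mxE.
    by apply/eqP; apply: contrapT => /negP vi; apply: v0; exists i.
  by exists (enum_val i); rewrite enum_valK.
move=> j; move/sub_kermxP/matrixP/(_ 0 (enum_rank j)): v_ker;
  rewrite !mxE => v_ker.
rewrite -[RHS]v_ker (reindex (@enum_val I predT)) /=;
  last by apply/onW_bij/enum_val_bij.
by apply: eq_bigr => i _; rewrite !mxE enum_valK enum_rankK.
Qed.

End FiniteLinearAlgebra.

Section NoDependence.
Local Open Scope ring_scope.
Variables (R : comNzRingType) (N k : nat) (p : nat -> {pred R}) (x : nat -> R).
Hypothesis p_prime : forall i, (i <= N)%N -> prime_ideal (p i).
Hypothesis p_sub : forall i, (i < N)%N -> {subset p i <= p i.+1}.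
Hypothesis x_notin : forall i, (i < N)%N -> x i \notin p i.
Hypothesis x_in : forall i, (i < N)%N -> x i \in p i.+1.
Variables (c : {ffun 'I_N -> 'I_k.+1} -> R).
Variable E : {set {ffun 'I_N -> 'I_k.+1}}.
Hypothesis E_neq0 : E != set0.
Hypothesis c_unit : forall e, e \in E -> exists b, b * c e = 1.

Let p0 i : (i <= N)%N -> 0 \in p i. Proof. by case/p_prime=> -[]. Qed.
Let pD i a b : (i <= N)%N -> a \in p i -> b \in p i -> a + b \in p i.
Proof.
by case/p_prime=> -[_ _ /(_ 1 a b) pD] _; rewrite mul1r in pD; apply: pD.
Qed.
Let pM i a b : (i <= N)%N -> b \in p i -> a * b \in p i.
Proof.
move=> iN pb; case/p_prime: (iN) => -[_ _ pM _].
by rewrite -[_ * _]addr0; apply: pM => //; apply: p0.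
Qed.

(** Along a strict chain of primes, elements [x i] of [p i.+1] outside [p i]
    satisfy no polynomial relation with unit coefficients.  In a relation, the
    smallest power of [x 0] can be cancelled since [x 0] is not in [p 0]; modulo
    [p 1], which contains [x 0], only the terms with that smallest power
    survive.  Repeating this with [x 1], [x 2] and so on isolates the
    lexicographically least term, whose coefficient is a unit. *)
Lemma no_dependence :
  \sum_(e in E) c e * \prod_(i < N) x i ^+ e i \notin p 0%N.
Proof.
apply/negP=> sum0.
(* [E'] collects the terms with lexicographically least exponents in the first
   [j] variables, divided by the powers of these variables. *)
have step j : (j <= N)%N -> exists E' : {set {ffun 'I_N -> 'I_k.+1}},
  [/\ E' != set0, E' \subset E,
      forall e e', e \in E' -> e' \in E' ->
        forall i : 'I_N, (i < j)%N -> e i = e' i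
    & \sum_(e in E') c e * \prod_(i < N | (j <= i)%N) x i ^+ e i \in p j].
  elim: j => [_|j IHj jN]; first by exists E; split.
  have [E' [/set0Pn[e0 e0E] E'E E'_agree sum_j]] := IHj (ltnW jN).
  pose J := Ordinal jN.
  case: (@arg_minnP _ e0 (mem E') (fun e => e J) e0E) => e1 /= e1E e1_min.
  pose T := \sum_(e in E') c e *
    (x j ^+ (e J - e1 J) * \prod_(i < N | (j < i)%N) x i ^+ e i).
  have sum_jE : \sum_(e in E') c e * \prod_(i < N | (j <= i)%N) x i ^+ e i =
      x j ^+ e1 J * T.
    rewrite big_distrr; apply: eq_bigr => e eE; rewrite [RHS]mulrCA.
    congr (_ * _); rewrite mulrA -exprD subnKC; last exact: e1_min.
    rewrite (bigD1 J) //=; congr (_ * _); apply: eq_bigl => i.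
    by rewrite ltn_neqAle andbC -val_eqE /= eq_sym.
  exists [set e in E' | e J == e1 J]; split.
  - by apply/set0Pn; exists e1; rewrite inE eqxx andbT.
  - by apply: subset_trans E'E; apply/subsetP=> e; rewrite inE => /andP[].
  - move=> e e'; rewrite !inE => /andP[eE /eqP eJ] /andP[eE' /eqP eJ'] i.
    rewrite ltnS leq_eqVlt => /orP[/eqP ij|]; last exact: E'_agree.
    have -> : i = J by apply: val_inj.
    by rewrite eJ eJ'.
  have T_in : T \in p j.+1.
    apply: (p_sub jN); move: sum_j; rewrite sum_jE.
    elim: (val (e1 J)) => [|a IHa]; first by rewrite mul1r.
    rewrite exprS -mulrA => /(p_prime (ltnW jN)).2 /orP[xj|//].
    by rewrite (negPf (x_notin jN)) in xj.
  move: T_in; rewrite /T.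
  rewrite (bigID (fun e : {ffun 'I_N -> 'I_k.+1} => e J == e1 J)) /=.
  set s1 := \sum_(e in E' | _) _; set s2 := \sum_(e in E' | _) _ => s12.
  have s2_in : s2 \in p j.+1.
    rewrite /s2; elim/big_ind: _ => [||e /andP[eE neJ]]; first exact: p0.
      by move=> a b; apply: pD.
    apply: pM => //; rewrite mulrC; apply: pM => //.
    have : (0 < e J - e1 J)%N.
      by rewrite subn_gt0 ltn_neqAle eq_sym neJ; apply: e1_min.
    by case: (_ - _)%N => // a _; rewrite exprSr; apply: pM => //; apply: x_in.
  have : s1 \in p j.+1.
    have -> : s1 = (s1 + s2) + (- 1) * s2 by rewrite mulN1r addrK.
    by apply: pD => //; apply: pM.
  suff -> : s1 = \sum_(e in [set e in E' | e J == e1 J])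
    c e * \prod_(i < N | (j < i)%N) x i ^+ e i by [].
  apply: eq_big => [e|e /andP[_ /eqP ->]]; first by rewrite inE.
  by rewrite subnn mul1r.
have [E' [/set0Pn[e eE] E'E agree]] := step N (leqnn N).
have E'1 : E' = [set e].
  apply/setP=> e'; rewrite inE; apply/idP/eqP=> [e'E|-> //].
  by apply/ffunP=> i; apply: agree.
rewrite E'1 big_set1 big_pred0 => [|i]; last by rewrite leqNgt ltn_ord.
rewrite mulr1 => ce; have [b b1] := c_unit (subsetP E'E _ eE).
have [[_ /negP p1 _] _] := p_prime (leqnn N).
by apply: p1; rewrite -b1; apply: pM.
Qed.

End NoDependence.

Section SpreadBound.
Local Open Scope ring_scope.
Local Open Scope quotient_scope.
Variables (K : fieldType) (n : nat).
Local Notation S := {mpoly K[n]}.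
Variables (G : 'X_{1..n} -> Prop) (d : nat).
Hypothesis G_bound : forall N,
  exists2 s : seq (nat * 'X_{1..n}), (size s <= N ^ d)%N &
    forall k m, (k < N)%N -> sums_of G k m -> (k, m) \in s.

Local Notation L := (monomial_ideal (K := K) G).
Local Notation pi_fiber := (\pi_({ideal_quot (@fiber_ideal _ _ L)})).

(** An exponent of [L^k] that is not a sum of [k] exponents in [G] is such a sum
    plus a nonzero exponent. *)
Lemma fiber_ideal_of_coef (F : rees_algebra L) :
  (forall k m, sums_of G k m -> (rees_val F)`_k@_m = 0) ->
  F \in fiber_ideal (L := L).
Proof.
move=> F0; apply/asboolP=> k; apply: mpoly_ind_supp.
- exact: ideal_gen0.
- exact: ideal_genD.
move=> m mF; have /asboolP/(_ k) Fk := rees_valP F.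
have [g Gg gm] := ideal_pow_supp Fk mF.
rewrite (scaleX_factor _ gm); apply: ideal_gen_mem.
exists ((rees_val F)`_k@_m *: 'X_[m - g]), 'X_[g]; split=> //;
  last exact: ideal_pow_X.
have : (m - g)%MM != 0%MM.
  apply/eqP=> mg0; move: mF; rewrite -(submK gm) mg0 add0m mcoeff_msupp.
  by rewrite F0 // eqxx.
rewrite -mdeg_eq0; set h := (m - g)%MM => h0.
have [i hi] : exists i, (h i != 0)%N.
  apply: contrapT => no_i; move: h0; rewrite mdegE big1 // => i _.
  by apply/eqP; apply: contrapT => /negP ?; apply: no_i; exists i.
have -> : h = (h - U_(i) + U_(i))%MM.
  rewrite submK //; apply/mnm_lepP=> j; rewrite mnm1E; case: eqP => // <-.
  by rewrite lt0n.
by rewrite mpolyXD scalerAl; apply/ideal_genM/ideal_gen_mem; exists i.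
Qed.

Let rees_const (a : K) : (a%:MP_[n])%:P \in rees L.
Proof.
apply/asboolP=> k; rewrite coefC; case: k => //= k; exact: ideal_gen0.
Qed.

Definition rees_scalar a : rees_algebra L := ReesAlgebra (rees_const a).

(** [G_bound] says that the fiber cone has dimension at most [N^d] in degrees
    below [N], which bounds its Krull dimension by [d]: the monomials in [d + 1]
    elements with all exponents at most [k] number [(k + 1)^(d + 1)], and lie in
    degrees below [C (k + 1)] for a constant [C], so they are linearly dependent
    for large [k]. *)
Lemma prime_chain_bound l : prime_chain (fiber_cone L) l -> (l <= d)%N.
Proof.
case=> p [p_prime p_lt]; rewrite leqNgt; apply/negP=> dl.
have /choice[x xP] : forall i, exists x,
    (i < l)%N -> x \notin p i /\ x \in p i.+1.
  move=> i; case: (ltnP i l) => [il|]; last by exists 0.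
  have [_ nsub] := p_lt i il.
  apply: contrapT => no_x; apply: nsub => x xp; apply: contrapT => /negP nxp.
  by apply: no_x; exists x.
pose z i : rees_algebra L := repr (x i).
pose B := (\max_(i < d.+1) size (rees_val (z i)))%N.
pose C := (d.+1 * B).+1.
(* The least [k] with [(C * k.+1) ^ d < k.+1 ^ d.+1]. *)
pose k := (C ^ d)%N.
have [s s_size sP] := G_bound (C * k.+1).
pose mon (e : {ffun 'I_d.+1 -> 'I_k.+1}) : rees_algebra L :=
  \prod_(i < d.+1) z i ^+ e i.
have lt_card : (#|'I_(size s)| < #|{ffun 'I_d.+1 -> 'I_k.+1}|)%N.
  rewrite card_ffun !card_ord; apply: leq_ltn_trans s_size _.
  by rewrite expnMn expnS ltn_pmul2r ?expn_gt0 //.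
have [c [[e0 c_e0] c_ker]] := exists_left_kernel
  (fun e (j : 'I_(size s)) => let: (k', m) := nth (0%N, 0%MM) s j in
     (rees_val (mon e))`_k'@_m)
  lt_card.
have size_mon e : (size (rees_val (mon e)) <= C * k.+1)%N.
  have val_prod : rees_val (mon e) = \prod_(i < d.+1) rees_val (z i) ^+ e i.
    rewrite /mon -[rees_val _]/(\val _) rmorph_prod /=.
    by apply: eq_bigr => i _; rewrite -[rees_val _]/(\val _) rmorphXn.
  have size_M (f g : {poly S}) a b :
      (size f <= a.+1 -> size g <= b.+1 -> size (f * g)%R <= (a + b).+1)%N.
    move=> fa gb; apply: leq_trans (size_polyMleq _ _) _.
    by rewrite -ltnS; apply: leq_trans (leqSpred _) _; lia.
  have size_X (i : 'I_d.+1) a : (size (rees_val (z i) ^+ a) <= (a * B).+1)%N.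
    elim: a => [|a IHa]; first by rewrite size_poly1.
    rewrite exprS mulSn; apply: size_M IHa; apply: leqW.
    exact: (leq_bigmax i).
  have : (size (\prod_(i < d.+1) rees_val (z i) ^+ e i)%R
          <= (\sum_(i < d.+1) e i * B).+1)%N.
    elim/big_rec2: _ => [|i a f _ le_a]; first by rewrite size_poly1.
    exact: size_M.
  rewrite val_prod => /leq_trans; apply.
  apply: (@leq_ltn_trans (\sum_(i < d.+1) k * B)).
    by apply: leq_sum => i _; rewrite leq_mul2r -ltnS ltn_ord orbT.
  by rewrite sum_nat_const card_ord /C; nia.
pose W : rees_algebra L := \sum_e rees_scalar (c e) * mon e.
have W_fib : W \in fiber_ideal (L := L).
  apply: fiber_ideal_of_coef => k' m Gm.
  have W_coef : (rees_val W)`_k'@_m = \sum_e c e * (rees_val (mon e))`_k'@_m.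
    rewrite -[rees_val _]/(\val _) /W rmorph_sum coef_sum raddf_sum /=.
    by apply: eq_bigr => e _; rewrite coefCM mcoeffCM.
  rewrite W_coef; case: (ltnP k' (C * k.+1)) => [lt_k'|le_k']; last first.
    by apply: big1 => e _;
      rewrite nth_default ?mcoeff0 ?mulr0 // (leq_trans (size_mon e)).
  have in_s := sP _ _ lt_k' Gm.
  rewrite -index_mem in in_s.
  by have := c_ker (Ordinal in_s); rewrite /= nth_index // -index_mem.
have W0 : pi_fiber W = 0.
  by apply/eqP; rewrite -(rmorph0 pi_fiber) -Quotient.idealrBE subr0.
have scalar0 : rees_scalar 0 = 0 by apply: val_inj; rewrite /= mpolyC0 polyC0.
have scalarM a b : rees_scalar (a * b) = rees_scalar a * rees_scalar b.
  by apply: val_inj; rewrite /= mpolyCM polyCM.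
have scalar1 : rees_scalar 1 = 1 by apply: val_inj; rewrite /= mpolyC1 polyC1.
have /negP[] : \sum_(e in [set e | c e != 0]) pi_fiber (rees_scalar (c e)) *
    \prod_(i < d.+1) x i ^+ e i \notin p 0%N.
  apply: no_dependence => [i il|i il|i il|i il||e].
  - by apply: p_prime; apply: leq_trans dl.
  - by apply: (p_lt i _).1; apply: leq_trans dl.
  - by apply: (xP i _).1; apply: leq_trans dl.
  - by apply: (xP i _).2; apply: leq_trans dl.
  - by apply/set0Pn; exists e0; rewrite inE.
  - rewrite inE => ce; exists (pi_fiber (rees_scalar (c e)^-1)).
    by rewrite -rmorphM -scalarM mulVf // scalar1 rmorph1.
have -> : \sum_(e in [set e | c e != 0]) pi_fiber (rees_scalar (c e)) *
    \prod_(i < d.+1) x i ^+ e i = pi_fiber W.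
  rewrite /W rmorph_sum [RHS](bigID (fun e => c e != 0)) /=.
  rewrite [X in _ = _ + X]big1 ?addr0 => [|e /negbNE/eqP ->]; last first.
    by rewrite scalar0 mul0r rmorph0.
  apply: eq_big => [e|e _]; first by rewrite inE.
  rewrite rmorphM rmorph_prod; congr (_ * _); apply: eq_bigr => i _.
  by rewrite -[in LHS](reprK (x i)) rmorphXn.
by rewrite W0; case: (p_prime 0%N isT) => -[].
Qed.

End SpreadBound.

(** * The Hibi ideal *)

Section HibiIdeal.
Variables (disp : Order.disp_t) (P : finPOrderType disp) (K : fieldType).
Implicit Types (I J A B : {set P}) (p q : P).
Local Notation nv := #|{: P + P}|.

Definition x_var p : 'I_nv := enum_rank (inl p : P + P)%type.
Definition y_var p : 'I_nv := enum_rank (inr p : P + P)%type.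

Definition hibi_exponent I : 'X_{1..nv} :=
  [multinom match enum_val i with
            | inl p => p \in I
            | inr p => p \notin I
            end : nat | i < nv].

Lemma hibi_exponent_x I p : hibi_exponent I (x_var p) = (p \in I).
Proof. by rewrite mnmE enum_rankK. Qed.

Lemma hibi_exponent_y I p : hibi_exponent I (y_var p) = (p \notin I).
Proof. by rewrite mnmE enum_rankK. Qed.

Lemma exponentP (m m' : 'X_{1..nv}) : (forall p, m (x_var p) = m' (x_var p)) ->
  (forall p, m (y_var p) = m' (y_var p)) -> m = m'.
Proof.
by move=> ex ey; apply/mnmP=> i; rewrite -(enum_valK i); case: (enum_val i).
Qed.

Lemma hibi_monomialE I : hibi_monomial K I = 'X_[hibi_exponent I]%R.
Proof.
rewrite mpolyXE_id (reindex (@enum_rank (P + P)%type)) /=; last first.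
  exact/onW_bij/enum_rank_bij.
rewrite big_sumType /= /hibi_monomial; congr (_ * _)%R; rewrite big_mkcond /=.
  apply: eq_bigr => p _; rewrite -/(x_var p) hibi_exponent_x.
  by case: (p \in I).
apply: eq_bigr => p _; rewrite -/(y_var p) hibi_exponent_y inE.
by case: (p \in I).
Qed.

Lemma mdeg_xy (m : 'X_{1..nv}) :
  mdeg m = (\sum_p (m (x_var p) + m (y_var p)))%N.
Proof.
rewrite mdegE (reindex (@enum_rank (P + P)%type)) /=;
  last by apply/onW_bij/enum_rank_bij.
by rewrite big_sumType /= big_split.
Qed.

Lemma mdeg_hibi I : mdeg (hibi_exponent I) = #|P|.
Proof.
rewrite mdeg_xy -[RHS]sum1_card; apply: eq_bigr => p _.
by rewrite hibi_exponent_x hibi_exponent_y; case: (p \in I).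
Qed.

Definition hibi_exponents (m : 'X_{1..nv}) :=
  exists2 I, I \in ideals P & m = hibi_exponent I.

Lemma hibi_idealE : hibi_ideal P K = monomial_ideal hibi_exponents.
Proof.
rewrite /hibi_ideal /monomial_ideal; congr ideal_gen.
apply/funext=> x; apply/propext; split.
  case=> I /idealsP iI ->; exists (hibi_exponent I); last exact: hibi_monomialE.
  by exists I.
by case=> m [I /idealsP iI ->] ->; exists I => //; rewrite hibi_monomialE.
Qed.

Lemma hibi_exponentsP (m : 'X_{1..nv}) :
  hibi_exponents m <-> m \in [seq hibi_exponent A | A <- enum (ideals P)].
Proof.
split=> [[I iI ->]|/mapP[I]]; first by rewrite map_f ?mem_enum.
by rewrite mem_enum => iI ->; exists I.
Qed.

Lemma hibi_exponent_inj : injective hibi_exponent.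
Proof.
move=> I J eIJ; apply/setP=> p;
  have := congr1 (fun m : 'X_{1..nv} => m (x_var p)) eIJ.
by rewrite /= !hibi_exponent_x; case: (p \in I); case: (p \in J).
Qed.

Lemma hibi_exponentUI I J :
  (hibi_exponent I + hibi_exponent J =
   hibi_exponent (I :&: J) + hibi_exponent (I :|: J))%MM.
Proof.
apply: exponentP => p; rewrite !mnmDE ?(hibi_exponent_x, hibi_exponent_y) !inE;
  by case: (p \in I); case: (p \in J).
Qed.

Definition pair_exponent (AB : {set P} * {set P}) :=
  (hibi_exponent AB.1 + hibi_exponent AB.2)%MM.

(** For nested ideals, [p] lies in the larger one if its [x]-exponent is at least
    [1] and in the smaller one if it is [2]. *)
Lemma pair_exponent_inj : {in nested P &, injective pair_exponent}.
Proof.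
move=> [A B] [A' B']; rewrite !in_set /= => /and3P[_ _ AB] /and3P[_ _ AB'] e.
have ex p : ((p \in A) + (p \in B) = (p \in A') + (p \in B'))%N.
  have := congr1 (fun m : 'X_{1..nv} => m (x_var p)) e.
  by rewrite /= !mnmDE !hibi_exponent_x.
have both p : (p \in A) = (p \in A') /\ (p \in B) = (p \in B').
  move: (ex p) (subsetP AB p) (subsetP AB' p).
  by case: (p \in A) (p \in B) (p \in A') (p \in B') => -[] [] [] //= _;
     [move/(_ isT) | move=> _ /(_ isT)].
by congr (_, _); apply/setP=> p; case: (both p).
Qed.

Lemma sums_of_hibi2 : sums_of hibi_exponents 2 =
  fun m => m \in [seq pair_exponent AB | AB <- enum (nested P)].
Proof.
apply/funext=> m; apply/propext; split; last first.
  case/mapP=> -[A B]; rewrite mem_enum in_set /= => /and3P[iA iB _] ->.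
  exists (hibi_exponent A), (hibi_exponent B); split=> //; first by exists A.
  exists (hibi_exponent B), 0%MM; split=> //; first by exists B.
  by rewrite addm0.
case=> _ [_ [[I iI ->] [_ [_ [[J iJ ->] -> ->]]] ->]].
rewrite addm0 hibi_exponentUI; apply/mapP; exists (I :&: J, I :|: J) => //.
rewrite mem_enum in_set /= (subset_trans (subsetIl _ _) (subsetUl _ _)) andbT.
apply/andP; split; apply/idealsP.
  by apply: poset_idealI; apply/idealsP.
by apply: poset_idealU; apply/idealsP.
Qed.

Lemma hibi_equigenerated : equigenerated_monomial (hibi_ideal P K) /\
  min_num_gens (hibi_ideal P K) #|ideals P|.
Proof.
have -> : hibi_ideal P K = monomial_ideal
    (fun m => m \in [seq hibi_exponent A | A <- enum (ideals P)]).
  rewrite hibi_idealE; congr monomial_ideal.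
  by apply/funext=> m; apply/propext/hibi_exponentsP.
have uniq_s : uniq [seq hibi_exponent A | A <- enum (ideals P)].
  by rewrite map_inj_uniq ?enum_uniq //; apply: hibi_exponent_inj.
have s_e m : m \in [seq hibi_exponent A | A <- enum (ideals P)] ->
    mdeg m = #|P|.
  by case/mapP=> I _ ->; apply: mdeg_hibi.
split; first exact: equigenerated_monomial_ideal uniq_s s_e.
by have := min_num_gens_monomial K uniq_s s_e; rewrite size_map -cardE.
Qed.

Lemma hibi_square_gens :
  min_num_gens (ideal_pow (hibi_ideal P K) 2) #|nested P|.
Proof.
rewrite hibi_idealE ideal_powE sums_of_hibi2.
have := @min_num_gens_monomial K _ (#|P| * 2)
  [seq pair_exponent AB | AB <- enum (nested P)].
rewrite size_map -cardE; apply.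
  rewrite map_inj_in_uniq ?enum_uniq // => AB AB'; rewrite !mem_enum.
  exact: pair_exponent_inj.
by move=> _ /mapP[AB _ ->]; rewrite mdegD !mdeg_hibi; lia.
Qed.

Lemma sums_of_hibi_balanced k m : sums_of hibi_exponents k m ->
  forall p, (m (x_var p) + m (y_var p) = k)%N.
Proof.
elim: k m => [m -> p|k IHk _ [_ [b [[I _ ->] /IHk b_bal ->]]] p];
  first by rewrite !mnm0E.
rewrite !mnmDE addnACA b_bal hibi_exponent_x hibi_exponent_y.
by case: (p \in I).
Qed.

(** The [x]-exponents and [k] determine the [y]-exponents of a generator of
    [H_P^k]. *)
Lemma sums_of_hibi_bound N : exists2 s : seq (nat * 'X_{1..nv}),
  (size s <= N ^ #|P|.+1)%N &
  forall k m, (k < N)%N -> sums_of hibi_exponents k m -> (k, m) \in s.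
Proof.
pose f (x : 'I_N * {ffun P -> 'I_N}) : nat * 'X_{1..nv} := (x.1 : nat,
  [multinom match enum_val i with
            | inl p => x.2 p : nat
            | inr p => x.1 - x.2 p
            end | i < nv]).
exists (codom f).
  by rewrite size_codom card_prod card_ffun !card_ord expnS.
move=> k m kN /sums_of_hibi_balanced m_bal.
have mN p : (m (x_var p) < N)%N.
  by apply: leq_ltn_trans kN; rewrite -(m_bal p) leq_addr.
apply/codomP; exists (Ordinal kN, [ffun p => Ordinal (mN p)]).
rewrite /f /=; congr (_, _); apply: exponentP => p;
  rewrite mnmE enum_rankK ffunE //=.
by rewrite -(m_bal p) addKn.
Qed.

(** The flag of faces for the lower bound: on the [i]-th face [x_p] does not occur
    for the last [i] elements [p] of a linear extension, and the ideal of the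
    other elements gives a generator on that face that is not on the next one. *)
Lemma hibi_analytic_spread : (0 < #|P|)%N ->
  analytic_spread (hibi_ideal P K) #|P|.+1.
Proof.
move=> P_gt0; rewrite /analytic_spread hibi_idealE; split; last first.
  by move=> l; apply: prime_chain_bound; apply: sums_of_hibi_bound.
have [r [r_ext r_lt]] := linear_extension_exists P.
have r_onto i : (i < #|P|)%N -> exists p, r p = i.
  move=> iP; pose f p : 'I_#|P| := Ordinal (r_lt p).
  have f_inj : injective f by move=> p q /(congr1 val)/= /r_ext.1.
  have /codomP[p /(congr1 val) /= ->] : Ordinal iP \in codom f.
    by apply: inj_card_onto; rewrite ?card_ord.
  by exists p.
apply: (@fiber_cone_prime_chain _ _ _ #|P| #|P|
  (fun i => [set x_var p | p in [set p | (#|P| - i <= r p)%N]])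
  (fun i => hibi_exponent [set p | (r p < #|P| - i)%N])) => //.
- by move=> m [I _ ->]; apply: mdeg_hibi.
- move=> i _; apply/imsetS/subsetP=> p; rewrite !inE.
  by apply: leq_trans; rewrite leq_sub2l.
- move=> i _; exists [set p | (r p < #|P| - i)%N] => //.
  apply/idealsP=> p q; rewrite !inE => rp /(linear_extension_le r_ext) rq.
  exact: leq_ltn_trans rp.
- move=> i _ _ /imsetP[p + ->]; rewrite inE => rp.
  by rewrite hibi_exponent_x inE ltnNge rp.
- move=> i iP; have [p rp] : exists p, r p = (#|P| - i.+1)%N.
    by apply: r_onto; lia.
  exists (x_var p); first by apply: imset_f; rewrite inE rp.
  rewrite hibi_exponent_x inE rp; have -> : (#|P| - i.+1 < #|P| - i)%N by lia.
  by [].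
Qed.

End HibiIdeal.

Lemma krull_dim_unique (R : comNzRingType) l l' :
  krull_dim R l -> krull_dim R l' -> l = l'.
Proof.
move=> [l_ch l_max] [l'_ch l'_max].
by apply/eqP; rewrite eqn_leq l'_max // l_max.
Qed.

Lemma freiman_hibi_card (K : fieldType) (disp : Order.disp_t)
    (P : finPOrderType disp) :
  (0 < #|P|)%N -> freiman (hibi_ideal P K) <->
  (#|nested P| + 'C(#|P|.+1, 2) = #|P|.+1 * #|ideals P|)%N.
Proof.
move=> P_gt0; have [H_equi H_mu] := hibi_equigenerated P K.
have H_mu2 := hibi_square_gens P K;
  have H_spread := hibi_analytic_spread K P_gt0.
have eqE (a b c d : nat) : (a%:Z = b%:Z * d%:Z - c%:Z)%R <-> (a + c = b * d)%N.
  by lia.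
split=> [[_ [mu [mu2 [l [mu_H mu2_H l_H]]]]]|/eqE card_eq].
  rewrite -(min_num_gens_unique H_mu mu_H) -(min_num_gens_unique H_mu2 mu2_H).
  by rewrite -(krull_dim_unique H_spread l_H) => /eqE.
by split=> //; exists #|ideals P|, #|nested P|, #|P|.+1; split.
Qed.

Theorem theorem3p4 (K : fieldType) (disp : Order.disp_t)
    (P : finPOrderType disp) (P_nonempty : (0 < #|P|)%N) :
  freiman (hibi_ideal P K) <->
  exists p : P, is_chain (~: [set p])%SET.
Proof.
exact: iff_trans (freiman_hibi_card K P_nonempty) (card_nested_eqP P_nonempty).
Qed.
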